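(* If $A$ and $B$ are finitely generated free groups and $G=A\rtimes B$ is a hyperbolic group, then $B$ is quasiconvex and malnormal in $G$.
   Context: In $A\rtimes B$ the subgroup $A$ is normal. ''Hyperbolic'' means Gromov-hyperbolic. A subgroup $B\le G$ is malnormal when $g^{-1}Bg\cap B=\{1\}$ for all $g\in G\smallsetminus B$. *)

(* Defs.v *)
From mathcomp Require Import all_boot all_order all_algebra all_fingroup.
From mathcomp Require Import boolp classical_sets.

Set Implicit Arguments.
Unset Strict Implicit.
Unset Printing Implicit Defensive.

Import Order.TTheory GRing.Theory Num.Theory.
Local Open Scope classical_set_scope.
Local Open Scope group_scope.

Section Groups.
Variable G : groupType.
Implicit Types (A B X : set G) (S : seq G) (g x y : G).

Definition is_subgroup A : Prop :=
  [/\ A 1, forall x y, A x -> A y -> A (x * y) & forall x, A x -> A x^-1].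

Definition is_normal A : Prop := forall g x, A x -> A (g^-1 * x * g).

(* G is the internal semidirect product of A (the normal factor) and B. *)
Definition is_semidirect A B : Prop :=
  [/\ is_subgroup A, is_subgroup B, is_normal A, A `&` B = [set 1]
    & forall g, exists a b, [/\ A a, B b & g = a * b]].

Definition malnormal B : Prop :=
  forall g, ~ B g -> [set g^-1 * b * g | b in B] `&` B = [set 1].

(* A letter (x, true) stands for x and (x, false) for the inverse of x. *)
Definition eval_word (w : seq (G * bool)) : G :=
  \prod_(u <- w) (if u.2 then u.1 else u.1^-1).

Definition reduced (w : seq (G * bool)) : bool :=
  sorted (fun u v => ~~ ((u.1 == v.1) && (u.2 != v.2))) w.

Definition word_in X (w : seq (G * bool)) : Prop :=
  forall u, u \in w -> X u.1.

(* A is free on X: sending a reduced word over X to its value in G is a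
   bijection onto A. *)
Definition free_on X A : Prop :=
  (forall w, word_in X w -> A (eval_word w)) /\
  (forall g, A g -> exists! w, [/\ word_in X w, reduced w & eval_word w = g]).

Definition is_free A : Prop := exists X, free_on X A.

Definition generates S A : Prop :=
  forall g, A g <-> exists2 w, word_in [set` S] w & eval_word w = g.

Definition finitely_generated A : Prop := exists S, generates S A.

(* The value 0 outside the subgroup generated by S is a junk value. *)
Definition word_length S g : nat :=
  let P n := `[< exists w, [/\ word_in [set` S] w, size w = n
                             & eval_word w = g] >] in
  if pselect (exists n, P n) is left ex then ex_minn ex else 0%N.

Definition word_dist S x y : nat := word_length S (x^-1 * y).

Definition cayley_edge S : rel G :=
  fun x y => (x^-1 * y \in S) || (y^-1 * x \in S).

(* The vertex sequence x :: p of an edge path of the Cayley graph is geodesic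
   when its length, size p, is the distance between its endpoints. *)
Definition cayley_geodesic S x (p : seq G) : bool :=
  path (cayley_edge S) x p && (size p == word_dist S x (last x p)).

Definition quasiconvex_wrt S B : Prop :=
  exists K : nat, forall x p, cayley_geodesic S x p -> B x -> B (last x p) ->
    forall z, z \in x :: p -> exists2 b, B b & (word_dist S z b <= K)%N.

(* Quantifying over all finite generating sets makes the notion independent of
   any choice; when G is hyperbolic one such set is as good as another. *)
Definition quasiconvex B : Prop :=
  forall S, generates S setT -> quasiconvex_wrt S B.

End Groups.

Section Hyperbolicity.
Local Open Scope ring_scope.

Definition gromov_product (T : Type) (d : T -> T -> nat) (o x y : T) : rat :=
  ((d o x)%:R + (d o y)%:R - (d x y)%:R) / 2.

Definition gromov_hyperbolic_space (T : Type) (d : T -> T -> nat) : Prop :=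
  exists2 delta : rat, 0 <= delta &
    forall o x y z : T,
      Num.min (gromov_product d o x y) (gromov_product d o y z) - delta
        <= gromov_product d o x z.

End Hyperbolicity.

Definition hyperbolic_group (G : groupType) : Prop :=
  exists2 S : seq G, generates S setT & gromov_hyperbolic_space (word_dist S).

(* Main.v *)
Require Import Defs.
From mathcomp Require Import all_boot all_order all_algebra all_fingroup.
From mathcomp Require Import boolp classical_sets.
From mathcomp Require Import zify lra.

(** In the Cayley graph of G, the factor B is a retract, so geodesics of G
    retract to Lipschitz paths in B. Hyperbolicity then forces geodesics with
    endpoints in B to stay near B, whatever the finite generating set, since
    geodesics for one generating set are quasigeodesics for another.

    If g^-1 b g lies in B with g = a c, a in A, c in B, then retracting to B
    gives a b = b a. When a and b are both nontrivial, powers of b grow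
    linearly because B is an undistorted free group, and hyperbolicity
    provides, for each k, an element h of B with a^k h in a ball of fixed
    radius. As A is torsion-free these elements are distinct, which is absurd in
    a finite ball. *)

Set Implicit Arguments.
Unset Strict Implicit.
Unset Printing Implicit Defensive.

(** * Exponential against linear growth *)

Lemma sqr_le_exp2 k : k * k <= 4 * 2 ^ k.
Proof.
elim: k => // k IHk; have := ltn_expl k (isT : 1 < 2).
by case: (leqP k 2) => [|k2]; [case: k IHk => [|[|[]]] | rewrite expnS; nia].
Qed.

(** A quadratic lower bound for [2 ^ k] suffices. Both hyperbolicity arguments below end this
    way. *)
Lemma exp2_le_linear a b k : 2 ^ k <= a * k + b -> k <= 4 * (a + b).
Proof. by have := sqr_le_exp2 k; nia. Qed.

(** * Stability of quasigeodesics in hyperbolic spaces *)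

Section CoarseHyperbolicity.
Variables (T : Type) (d : T -> T -> nat).

Definition is_pseudometric : Prop :=
  [/\ forall x, d x x = 0, forall x y, d x y = d y x
    & forall y x z, d x z <= d x y + d y z].

(** Gromov's inequality, doubled and with the products expanded so that only natural numbers occur;
    [N] replaces twice delta. *)
Definition four_point (N : nat) : Prop :=
  forall o x y z,
    d x z + d o y <= maxn (d x y + d o z) (d y z + d o x) + N.

Lemma gromov_hyperbolic_four_point :
  gromov_hyperbolic_space d -> exists N, four_point N.
Proof.
case=> delta delta0 hyp; exists (Num.bound (2 * delta)%R) => o x y z.
have := hyp o x y z; rewrite /gromov_product.
have := Num.Theory.archi_boundP (_ : 0 <= 2 * delta)%R.
move=> /(_ ltac:(lra)); set N := Num.bound _ => ltN.
rewrite -(Num.Theory.ler_nat rat) !GRing.natrD Order.POrderTheory.minEle.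
case: ifP => _ ineq; [have := leq_maxl (d x y + d o z) (d y z + d o x)
  | have := leq_maxr (d x y + d o z) (d y z + d o x)];
  rewrite -(Num.Theory.ler_nat rat) !GRing.natrD; lra.
Qed.

Variable N : nat.
Hypotheses (metric_d : is_pseudometric) (hyp_d : four_point N).

Let dxx x : d x x = 0. Proof. by case: metric_d. Qed.
Let dC x y : d x y = d y x. Proof. by case: metric_d. Qed.
Let dD y x z : d x z <= d x y + d y z. Proof. by case: metric_d. Qed.

(* [2 * D + d x y <= d z x + d z y] says that the Gromov product of x and y
   at z is at least D. *)
Lemma gromov_product_chain (u : nat -> T) z D lam k i j :
    i <= j <= i + 2 ^ k ->
    (forall l, i <= l <= j -> D <= d z (u l)) ->
    (forall l, i <= l < j -> d (u l) (u l.+1) <= lam) ->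
  2 * D + d (u i) (u j) <= d z (u i) + d z (u j) + lam + N * k.
Proof.
elim: k i j => [|k IHk] i j.
  rewrite expn0 addn1 => /andP[ij ji] far step.
  have fi : D <= d z (u i) by apply: far; lia.
  have [->|eq] : j = i \/ j = i.+1 by lia.
    by rewrite dxx; lia.
  have fj : D <= d z (u j) by apply: far; lia.
  by have := step i; rewrite eq leqnn ltnSn => /(_ isT); rewrite eq in fj; lia.
rewrite expnS => /andP[ij ji] far step.
case: (leqP j (i + 2 ^ k)) => jm.
  by have := IHk i j; rewrite ij jm => /(_ isT far step); lia.
(* Each halving of the chain costs one four-point inequality, hence one [N]: the loss is logarithmic
   in the length. *)
set m := i + 2 ^ k in jm *.
have H1 := IHk i m; have H2 := IHk m j.
have {}H1 : 2 * D + d (u i) (u m) <= d z (u i) + d z (u m) + lam + N * k.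
  by apply: H1 => [|l Hl|l Hl]; [lia|apply: far; lia|apply: step; lia].
have {}H2 : 2 * D + d (u m) (u j) <= d z (u m) + d z (u j) + lam + N * k.
  by apply: H2 => [|l Hl|l Hl]; [lia|apply: far; lia|apply: step; lia].
have := hyp_d z (u i) (u m) (u j); lia.
Qed.

Definition coarsely_undistorted (lam : nat) (Y : T -> Prop) : Prop :=
  forall u v, Y u -> Y v -> exists n (q : nat -> T),
    [/\ q 0 = u /\ q n = v, n <= lam * d u v,
        forall i, i <= n -> Y (q i)
      & forall i, i < n -> d (q i) (q i.+1) <= lam].

Definition geodesic (L : nat) (c : nat -> T) : Prop :=
  forall i j, i <= j <= L -> d (c i) (c j) = j - i.

(* Take z on the geodesic at maximal distance D from Y, and points of the
   geodesic at distance 2 D before and after z. A path through Y joining them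
   has length O(D) and stays D-far from z, so that their Gromov product at z is
   D - O(log D); but it vanishes, as z lies between them. *)
Lemma geodesic_near_undistorted lam : exists K, forall Y L c,
    coarsely_undistorted lam Y -> geodesic L c -> Y (c 0) -> Y (c L) ->
    forall t, t <= L -> exists2 y, Y y & d (c t) y <= K.
Proof.
(* [J] will bound the number [k] of halvings: for [n > 1], [2 ^ k <= 2 * n <= 6 * lam * (2 * D)],
   while [2 * D <= lam + N * (k + 2)]. *)
pose J := 4 * (6 * lam * N + (6 * lam * (lam + 2 * N) + 2)).
exists (lam + N * (J + 2)) => Y L c undist geo Y0 YL.
pose near D := `[< forall t, t <= L -> exists2 y, Y y & d (c t) y <= D >].
have exD : exists D, near D.
  exists L; apply/asboolP => t tL; exists (c 0) => //.
  by rewrite dC geo; lia.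
case: (ex_minnP exD) => D /asboolP nearD minD.
suff leD : D <= lam + N * (J + 2).
  by move=> t /nearD[y Yy dy]; exists y => //; lia.
case: (posnP D) => [->//|D0].
have [t0 t0L far] : exists2 t, t <= L & forall y, Y y -> D <= d (c t) y.
  apply: contrapT => noT; suff : near D.-1 by move=> /minD; lia.
  apply/asboolP => t tL; apply: contrapT => noY; apply: noT; exists t => // y Yy.
  by rewrite leqNgt; apply/negP => dy; apply: noY; exists y => //; lia.
(* Both times are clipped to the geodesic, [s] by truncated subtraction. A clipped end lies in [Y]
   and serves as its own nearby point. *)
pose s := t0 - 2 * D; pose e := minn L (t0 + 2 * D).
have [y1 Yy1 [dy1 gy1]] : exists2 y, Y y & d (c s) y <= D /\
    2 * D + d (c s) y <= d (c t0) (c s) + d (c t0) y.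
  case: (leqP t0 (2 * D)) => ts.
    have -> : s = 0 by lia.
    by exists (c 0); rewrite ?dxx //; have := far _ Y0; lia.
  have [|y Yy dy] := nearD s; first by lia.
  exists y => //; split=> //; have := far _ Yy.
  have -> : d (c t0) (c s) = 2 * D by rewrite dC geo; lia.
  by lia.
have [y2 Yy2 [dy2 gy2]] : exists2 y, Y y & d (c e) y <= D /\
    2 * D + d (c e) y <= d (c t0) (c e) + d (c t0) y.
  case: (leqP L (t0 + 2 * D)) => ts.
    have -> : e = L by lia.
    by exists (c L); rewrite ?dxx //; have := far _ YL; lia.
  have [|y Yy dy] := nearD e; first by lia.
  exists y => //; split=> //; have := far _ Yy.
  have -> : d (c t0) (c e) = 2 * D by rewrite geo; lia.
  by lia.
have dts : d (c s) (c t0) = t0 - s by rewrite geo; lia.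
have dte : d (c t0) (c e) = e - t0 by rewrite geo; lia.
have dse : d (c s) (c e) = e - s by rewrite geo; lia.
have dts' := dC (c s) (c t0).
have [n [q [[q0 qn] len inY step]]] := undist _ _ Yy1 Yy2.
have n6 : n <= lam * (6 * D).
  apply: leq_trans len _; rewrite leq_mul2l; apply/orP; right.
  by have := dD (c s) y1 y2; have := dD (c e) (c s) y2; have := dC y1 (c s); lia.
pose k := up_log 2 n.
have nk : n <= 2 ^ k by apply: up_logP.
have chain : 2 * D + d y1 y2 <= d (c t0) y1 + d (c t0) y2 + lam + N * k.
  rewrite -q0 -qn; apply: gromov_product_chain => [|l Hl|l Hl]; first by lia.
    by apply/far/inY; lia.
  by apply: step; lia.
have p1 := hyp_d (c t0) (c s) y1 y2; have p2 := hyp_d (c t0) (c s) y2 (c e).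
have dy2C := dC y2 (c e).
have bound : 2 * D <= lam + N * (k + 2) by lia.
suff kJ : k <= J.
  have : N * (k + 2) <= N * (J + 2) by rewrite leq_mul2l leq_add2r kJ orbT.
  by lia.
case: (leqP n 1) => n1; first by rewrite /k; case: (n) n1 => [|[]].
have /andP[klt _] := up_log_bounds (isT : 1 < 2) n1.
have k0 : 0 < k by rewrite /k up_log_gt0.
apply: exp2_le_linear.
have : 2 ^ k <= 2 * n by rewrite -(prednK k0) expnS leq_mul2l ltnW.
have : 6 * lam * (2 * D) <= 6 * lam * (lam + N * (k + 2)).
  by rewrite leq_mul2l bound orbT.
by lia.
Qed.

(* A Lipschitz path whose parametrisation is undistorted is itself coarsely
   undistorted, so it passes near all points of the geodesic c; as c is
   connected, near each point of the path there is a point of c. *)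
Lemma quasigeodesic_near_geodesic lam : exists K, forall n (p : nat -> T) L c,
    (forall i j, i <= j <= n -> j - i <= lam * d (p i) (p j)) ->
    (forall i j, i <= j <= n -> d (p i) (p j) <= lam * (j - i)) ->
    geodesic L c -> c 0 = p 0 -> c L = p n ->
  forall i, i <= n -> exists2 t, t <= L & d (p i) (c t) <= K.
Proof.
have [K HK] := geodesic_near_undistorted lam.
exists (K + lam * (lam * (2 * K + 1))) => n p L c lowp upp geo c0 cL i i_n.
pose Y y := exists2 j, j <= n & y = p j.
have undist : coarsely_undistorted lam Y.
  move=> _ _ [j1 j1n ->] [j2 j2n ->]; case: (leqP j1 j2) => [j12|/ltnW j21].
    exists (j2 - j1), (fun l => p (j1 + l)).
    split=> [| |l Hl|l Hl]; first by rewrite addn0 subnKC.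
    - by apply: lowp; rewrite j12.
    - by exists (j1 + l) => //; lia.
    have := upp (j1 + l) (j1 + l.+1); rewrite addnS subSnn muln1; apply; lia.
  exists (j1 - j2), (fun l => p (j1 - l)).
  split=> [| |l Hl|l Hl]; first by rewrite subn0 subKn.
  - by rewrite dC; apply: lowp; rewrite j21.
  - by exists (j1 - l) => //; lia.
  rewrite dC; have := upp (j1 - l.+1) (j1 - l).
  by rewrite (_ : j1 - l - _ = 1) ?muln1; [apply; lia | lia].
have Y0 : Y (c 0) by exists 0.
have YL : Y (c L) by exists n.
have nearY := HK Y L c undist geo Y0 YL.
(* At the first time when [c] is near some [p j] with [i <= j], it is within one step of being near
   some [p j0] with [j0 <= i]. Then [p j0] and [p j] are [2 * K + 1]-close, which bounds
   [i - j0]. *)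
pose late t := `[< t <= L /\ exists2 j, i <= j <= n & d (c t) (p j) <= K >].
have exl : exists t, late t.
  exists L; apply/asboolP; split=> //; exists n; rewrite ?i_n ?leqnn //.
  by rewrite cL dxx.
case: (ex_minnP exl) => t /asboolP[tL [j /andP[ij jn] dj]] mint.
have [j0 j0i [t' t'L dj0]] : exists2 j0, j0 <= i &
    exists2 t', t' <= L & d (c t') (p j0) <= K /\ d (c t') (c t) <= 1.
  case: t tL dj mint => [|t] tL dj mint.
    by exists 0 => //; exists 0; rewrite // c0 !dxx.
  have [|_ [j0 j0n ->] dj0] := nearY t; first by lia.
  exists j0; last first.
    by exists t; [lia | rewrite geo ?dj0 ?subSnn //; lia].
  rewrite leqNgt; apply/negP => lt_i.
  suff /mint : late t by lia.
  by apply/asboolP; split; [lia | exists j0; rewrite // ltnW].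
case: dj0 => dj0 dt; exists t' => //.
have jj0 : d (p j0) (p j) <= 2 * K + 1.
  have := dD (c t') (p j0) (p j); have := dD (c t) (c t') (p j).
  by have := dC (c t') (p j0); lia.
have i_j0 : i - j0 <= lam * (2 * K + 1).
  have := lowp j0 j; rewrite jn (leq_trans j0i ij) => /(_ isT) low.
  have : lam * d (p j0) (p j) <= lam * (2 * K + 1) by rewrite leq_mul2l jj0 orbT.
  by lia.
have := upp j0 i; rewrite j0i i_n => /(_ isT) up.
have : lam * (i - j0) <= lam * (lam * (2 * K + 1)) by rewrite leq_mul2l i_j0 orbT.
have := dD (p j0) (p i) (c t'); have := dC (p j0) (p i).
by have := dC (p j0) (c t'); lia.
Qed.

End CoarseHyperbolicity.

(** * Lipschitz paths and geodesics *)

Section Paths.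
Variables (T : Type) (d : T -> T -> nat).
Hypothesis metric_d : is_pseudometric d.

Lemma lipschitz_path lam n (c : nat -> T) :
    (forall i, i < n -> d (c i) (c i.+1) <= lam) ->
  forall i j, i <= j <= n -> d (c i) (c j) <= lam * (j - i).
Proof.
case: metric_d => dxx _ dD step i j /andP[]; elim: j => [|j IHj].
  by rewrite leqn0 => /eqP->; rewrite dxx.
rewrite leq_eqVlt => /predU1P[->|ij] jn; first by rewrite dxx.
rewrite subSn // mulnS.
have := dD (c j) (c i) (c j.+1); have := IHj ij (ltnW jn).
by have := step j jn; lia.
Qed.

(** A shortcut between two intermediate points would bring the ends closer than [n]. *)
Lemma shortest_path_geodesic n (c : nat -> T) :
    (forall i, i < n -> d (c i) (c i.+1) <= 1) -> d (c 0) (c n) = n ->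
  geodesic d n c.
Proof.
case: (metric_d) => dxx _ dD step total i j /andP[ij jn].
have lip := lipschitz_path step.
have := lip 0 i; have := lip i j; have := lip j n.
have := dD (c i) (c 0) (c n); have := dD (c j) (c i) (c n); lia.
Qed.

End Paths.

Local Open Scope classical_set_scope.
Local Open Scope group_scope.

(** * Words and their values *)

Section Words.
Variable G : groupType.
Implicit Types (X : set G) (w : seq (G * bool)) (g x y : G).

Definition letter (u : G * bool) : G := if u.2 then u.1 else u.1^-1.

Definition word_inv w : seq (G * bool) := rev [seq (u.1, ~~ u.2) | u <- w].

Lemma eval_word_cons u w : eval_word (u :: w) = letter u * eval_word w.
Proof. by rewrite /eval_word big_cons. Qed.

Lemma eval_word_cat w1 w2 : eval_word (w1 ++ w2) = eval_word w1 * eval_word w2.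
Proof. by rewrite /eval_word big_cat. Qed.

Lemma eval_word1 u : eval_word [:: u] = letter u.
Proof. by rewrite eval_word_cons /eval_word big_nil mulg1. Qed.

Lemma eval_word_nil : eval_word [::] = 1 :> G.
Proof. exact: big_nil. Qed.

Lemma eval_word_inv w : eval_word (word_inv w) = (eval_word w)^-1.
Proof.
elim: w => [|[x b] w IHw]; first by rewrite eval_word_nil invg1.
rewrite /word_inv map_cons rev_cons -cats1 eval_word_cat -/(word_inv w) IHw.
by rewrite eval_word1 eval_word_cons invMg /letter /=; case: b; rewrite ?invgK.
Qed.

Lemma size_word_inv w : size (word_inv w) = size w.
Proof. by rewrite size_rev size_map. Qed.

Lemma word_in_nil X : word_in X [::].
Proof. by []. Qed.

Lemma word_in_cons X u w : word_in X (u :: w) <-> X u.1 /\ word_in X w.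
Proof.
split=> [Xw|[Xu Xw] v]; last by rewrite inE => /predU1P[->|/Xw].
by split=> [|v wv]; apply: Xw; rewrite inE ?eqxx ?wv ?orbT.
Qed.

Lemma word_in_cat X w1 w2 :
  word_in X (w1 ++ w2) <-> word_in X w1 /\ word_in X w2.
Proof.
split=> [Xw|[Xw1 Xw2] v]; last by rewrite mem_cat => /orP[/Xw1|/Xw2].
by split=> v wv; apply: Xw; rewrite mem_cat wv ?orbT.
Qed.

Lemma word_in_inv X w : word_in X w -> word_in X (word_inv w).
Proof. by move=> Xw u; rewrite mem_rev => /mapP[v /Xw Xv ->]. Qed.

End Words.

(** * Word metrics *)

Section WordMetric.
Variables (G : groupType) (S : seq G).
Hypothesis genS : generates S setT.
Implicit Types (w : seq (G * bool)) (g x y : G).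

Lemma word_length_le w :
  word_in [set` S] w -> word_length S (eval_word w) <= size w.
Proof.
move=> Sw; rewrite /word_length; case: pselect => // ex.
by case: ex_minnP => m _; apply; apply/asboolP; exists w.
Qed.

Lemma shortest_word g : exists w,
  [/\ word_in [set` S] w, size w = word_length S g & eval_word w = g].
Proof.
rewrite /word_length; case: pselect => [ex|[]].
  by case: ex_minnP => m /asboolP[w [Sw <- <-]] _; exists w.
by have [w Sw wg] := (genS g).1 I; exists (size w); apply/asboolP; exists w.
Qed.

Lemma word_length1 : word_length S 1 = 0.
Proof.
have := word_length_le (word_in_nil [set` S]).
by rewrite eval_word_nil leqn0 => /eqP.
Qed.

Lemma word_lengthM x y :
  word_length S (x * y) <= word_length S x + word_length S y.
Proof.
have [[u [Su <- <-]] [v [Sv <- <-]]] := (shortest_word x, shortest_word y).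
by rewrite -eval_word_cat -size_cat; apply: word_length_le; apply/word_in_cat.
Qed.

Lemma word_lengthV x : word_length S x^-1 = word_length S x.
Proof.
have le y : word_length S y^-1 <= word_length S y.
  have [w [Sw <- <-]] := shortest_word y.
  by rewrite -eval_word_inv -size_word_inv; apply: word_length_le; apply: word_in_inv.
by apply/eqP; rewrite eqn_leq le -{1}(invgK x) le.
Qed.

Lemma word_dist_pseudometric : is_pseudometric (word_dist S).
Proof.
rewrite /word_dist; split=> [x|x y|y x z]; first by rewrite mulVg word_length1.
  by rewrite -word_lengthV invMg invgK.
by apply: leq_trans (word_lengthM _ _); rewrite -mulgA mulVKg.
Qed.

Lemma word_dist_mul2l g x y : word_dist S (g * x) (g * y) = word_dist S x y.
Proof. by rewrite /word_dist invMg -mulgA mulKg. Qed.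

Lemma word_dist1 g : word_dist S 1 g = word_length S g.
Proof. by rewrite /word_dist invg1 mul1g. Qed.

Lemma word_length_letter u : u.1 \in S -> word_length S (letter u) <= 1.
Proof.
by move=> Su; rewrite -eval_word1; apply: word_length_le; apply/word_in_cons.
Qed.

Lemma word_length_edge x y : cayley_edge S x y -> word_dist S x y <= 1.
Proof.
case/orP => Sxy; first by rewrite /word_dist (word_length_letter (u := (_, true))).
have [_ -> _] := word_dist_pseudometric.
by rewrite /word_dist (word_length_letter (u := (_, true))).
Qed.

(** The prefixes of a shortest word for [x^-1 * y] trace the path. *)
Lemma exists_geodesic x y : exists c : nat -> G,
  [/\ geodesic (word_dist S) (word_dist S x y) c, c 0 = x
    & c (word_dist S x y) = y].
Proof.
have [w [Sw sw ew]] := shortest_word (x^-1 * y).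
pose c i := x * eval_word (take i w).
have c0 : c 0 = x by rewrite /c take0 eval_word_nil mulg1.
have cn : c (size w) = y by rewrite /c take_size ew mulVKg.
rewrite -[word_dist S x y]sw; exists c; split=> //.
apply: shortest_path_geodesic; first exact: word_dist_pseudometric.
  move=> i iw; rewrite word_dist_mul2l.
  rewrite (take_nth (1, true)) // -cats1 eval_word_cat eval_word1 /word_dist mulKg.
  by apply: word_length_letter; apply/Sw/mem_nth.
by rewrite c0 cn sw.
Qed.

(* R g n reads "g has size at most n"; the sizes of a product add up. *)
Lemma subadditive_bound (R : G -> nat -> Prop) :
    R 1 0 -> (forall g m n, m <= n -> R g m -> R g n) ->
    (forall x y m n, R x m -> R y n -> R (x * y) (m + n)) ->
    (forall g, exists n, R g n) ->
  exists M, forall g, R g (M * word_length S g)%N.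
Proof.
move=> R1 Rle RM /choice[f Rf].
pose M := \sum_(s <- S) maxn (f s) (f s^-1); exists M => g.
have Ru u : u.1 \in S -> R (letter u) M.
  case: u => s b /= Ss; have : maxn (f s) (f s^-1) <= M.
    by rewrite /M (big_rem s) //= leq_addr.
  rewrite geq_max => /andP[fs fV].
  by rewrite /letter; case: b => /=; apply: Rle (Rf _).
have [w [Sw <- <-]] := shortest_word g.
elim: w Sw => [|u w IHw]; first by rewrite eval_word_nil muln0.
case/word_in_cons => Su /IHw Rw; rewrite eval_word_cons mulnS.
exact: RM (Ru u Su) Rw.
Qed.

Lemma finite_ball K : exists E : seq G, forall g, word_length S g <= K -> g \in E.
Proof.
suff [E HE] : exists E : seq G, forall w,
    word_in [set` S] w -> size w <= K -> eval_word w \in E.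
  by exists E => g; have [w [Sw <- <-]] := shortest_word g; apply: HE.
elim: K => [|K [E HE]].
  by exists [:: 1] => w _; rewrite leqn0 size_eq0 => /eqP->; rewrite eval_word_nil inE.
exists (1 :: [seq letter u * e | u <- [seq (s, b) | s <- S,
                                        b <- [:: true; false]], e <- E]).
case=> [_ _|[s b] w]; first by rewrite eval_word_nil inE eqxx.
case/word_in_cons => Ss Sw sw; rewrite inE; apply/orP; right.
rewrite eval_word_cons; apply/allpairsP; exists ((s, b), eval_word w).
split=> //; last exact: HE.
by apply/allpairsP; exists (s, b); rewrite Ss; split=> //; case: (b).
Qed.

End WordMetric.

(** * Growth of powers in free groups *)

Section FreeGroups.
Variable G : groupType.
Implicit Types (X F : set G) (w v : seq (G * bool)).

Local Notation no_cancel :=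
  (fun u v : G * bool => ~~ ((u.1 == v.1) && (u.2 != v.2))).

Lemma letter_cancel (u v : G * bool) :
  ~~ no_cancel u v -> letter u * letter v = 1.
Proof.
case: u v => [x b] [y c]; rewrite /letter negbK /= => /andP[/eqP->].
by case: b c => [] [] //=; rewrite ?mulgV ?mulVg.
Qed.

(** A letter put before a reduced word can cancel only its first letter. *)
Lemma reduce_word X w : word_in X w -> exists v,
  [/\ word_in X v, reduced v, eval_word v = eval_word w & size v <= size w].
Proof.
elim: w => [_|u w IHw]; first by exists [::].
case/word_in_cons => Xu /IHw[v [Xv red_v ev sv]].
case: v => [|z v] in Xv red_v ev sv *.
  by exists [:: u]; rewrite !eval_word_cons -ev; split=> //; apply/word_in_cons.
case: (boolP (no_cancel u z)) => [uz|/letter_cancel uz].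
  exists [:: u, z & v]; split=> //; first by apply/word_in_cons.
    by rewrite /reduced /= uz.
  by rewrite [in RHS]eval_word_cons -ev -eval_word_cons.
exists v; split; first by case/word_in_cons: Xv.
- exact: path_sorted red_v.
- by rewrite eval_word_cons -ev eval_word_cons mulgA uz mul1g.
- by rewrite /= in sv *; lia.
Qed.

(** Here [path.cycle] expresses cyclic reducedness: the last letter does not cancel the first, and
    such pairs are the only new neighbours in a power. *)
Lemma reduced_power w n : path.cycle no_cancel w -> reduced (flatten (nseq n w)).
Proof.
case: w => [_|u w]; first by elim: n.
rewrite /= rcons_path => /andP[uw wu]; apply: (@path_sorted _ _ (last u w)).
by elim: n => //= n IHn; rewrite wu cat_path uw.
Qed.

(* A reduced word that is not cyclically reduced is conjugate to a shorter one,
   which costs two letters; powers of a cyclically reduced word are reduced. *)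
Lemma reduced_word_power_growth X F w : free_on X F ->
    word_in X w -> reduced w -> w != [::] ->
  exists c, forall n v, word_in X v -> eval_word v = eval_word w ^+ n ->
    n <= size v + c.
Proof.
case=> inF uniqF; have [k] := ubnP (size w).
elim: k w => // k IHk w wk Xw red_w w0.
case: (boolP (path.cycle no_cancel w)) => [cyc|].
  exists 0 => n v Xv ev; have [v' [Xv' red_v' ev' sv']] := reduce_word Xv.
  have Xwn : word_in X (flatten (nseq n w)).
    by elim: n {ev} => //= n IHn; apply/word_in_cat.
  have ewn : eval_word (flatten (nseq n w)) = eval_word w ^+ n.
    elim: n {ev Xwn} => [|n IHn]; first by rewrite eval_word_nil.
    by rewrite /= eval_word_cat IHn expgS.
  (* By uniqueness, the reduced form of [v] is the [n]-fold repetition of [w], of length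
     [n * size w]. *)
  have [w1 [_ w1P]] := uniqF _ (inF _ Xwn).
  have v'E := w1P _ (And3 Xwn (reduced_power n cyc) erefl).
  have := w1P v'; rewrite ewn => /(_ (And3 Xv' red_v' (etrans ev' ev))) v'E'.
  rewrite addn0; apply: leq_trans sv'; rewrite -v'E' v'E size_flatten.
  rewrite /shape map_nseq sumn_nseq leq_pmull //.
  by rewrite lt0n size_eq0.
case: w => [|u t] // in wk Xw red_w w0 *.
rewrite /= rcons_path; rewrite /reduced /= in red_w; rewrite red_w /=.
case/lastP: t => [|m z] in wk Xw red_w w0 *; first by rewrite /= !eqxx.
rewrite last_rcons => zu; have uz : ~~ no_cancel u z.
  by move: zu; rewrite eq_sym [z.2 == _]eq_sym.
move: red_w; rewrite rcons_path => /andP[um mz].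
have {Xw} [Xu Xm] : X u.1 /\ word_in X m.
  by move: Xw; rewrite -cats1 => /word_in_cons[? /word_in_cat[]].
(* The middle is nonempty, since [u] and [z] cancel and so cannot be adjacent in a reduced word. *)
case: m => [|y m] in wk w0 um mz Xm *; first by rewrite /= (negPf uz) in mz.
have [] := IHk (y :: m) _ Xm (path_sorted um) isT.
  by rewrite /= size_rcons in wk *; lia.
move=> c growth; exists (c + 2) => n v Xv ev.
have zV : letter z = (letter u)^-1 by rewrite (mulg1_eq (letter_cancel uz)).
have := growth n ((u.1, ~~ u.2) :: rcons v u).
rewrite /= size_rcons; suff: eval_word ((u.1, ~~ u.2) :: rcons v u) =
    eval_word (y :: m) ^+ n.
  move=> -> le; suff : n <= (size v).+2 + c by lia.
  by apply: le => //; rewrite -cats1; apply/word_in_cons; split=> //;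
    apply/word_in_cat; split=> //; apply/word_in_cons.
have uV : letter (u.1, ~~ u.2) = (letter u)^-1.
  by rewrite /letter; case: (u) => x []; rewrite /= ?invgK.
have ew : eval_word (u :: rcons (y :: m) z) = eval_word (y :: m) ^ (letter u)^-1.
  by rewrite eval_word_cons -cats1 eval_word_cat eval_word1 zV conjgE invgK.
rewrite -cats1 eval_word_cons eval_word_cat eval_word1 ev ew uV -conjXg.
by rewrite -conjgE conjgKV.
Qed.

Lemma free_power_growth X F b : free_on X F -> F b -> b <> 1 ->
  exists c, forall n v, word_in X v -> eval_word v = b ^+ n -> n <= size v + c.
Proof.
move=> freeF Fb b1; have [w [[Xw red_w ew] _]] := freeF.2 b Fb.
rewrite -ew; apply: reduced_word_power_growth freeF Xw red_w _.
by apply/eqP => w0; apply: b1; rewrite -ew w0 eval_word_nil.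
Qed.

(** If [a ^+ n = 1], the empty word represents [a ^+ (n * c.+1)], so linear growth gives
    [n * c.+1 <= c]. *)
Lemma free_torsion_free F a n :
  is_free F -> F a -> a <> 1 -> a ^+ n = 1 -> n = 0.
Proof.
case=> X freeF Fa a1 an.
have [c /(_ (n * c.+1)%N [::])] := free_power_growth freeF Fa a1.
rewrite eval_word_nil expgnA an expg1n => /(_ (word_in_nil X) erefl) /=.
by case: n {an} => // n; rewrite mulSn; lia.
Qed.

End FreeGroups.

(** * Retracts and quasiconvexity *)

Section Retracts.
Variable G : groupType.
Implicit Types (A B : set G) (S : seq G) (r : G -> G).

Definition retraction B r : Prop :=
  [/\ forall x y, r (x * y) = r x * r y, forall x, B (r x)
    & forall b, B b -> r b = b].

(** This is the projection onto [G / A], identified with [B]; it is well defined because [A] and [B]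
    meet trivially. *)
Lemma semidirect_retraction A B : is_semidirect A B ->
  exists2 r, retraction B r & forall x, A (x * (r x)^-1).
Proof.
case=> [[A1 AM AV] [B1 BM BV] nA AB AxB].
have uniqAB a a' b b' : A a -> A a' -> B b -> B b' -> a * b = a' * b' -> b = b'.
  move=> Aa Aa' Bb Bb' eq.
  have : (A `&` B) (a'^-1 * a).
    split; first by apply: AM => //; apply: AV.
    rewrite (_ : a'^-1 * a = b' * b^-1); first by apply: BM => //; apply: BV.
    by apply: (canRL (mulgK _)); rewrite -mulgA eq mulKg.
  rewrite AB => /= /(canRL (mulVKg _)); rewrite mulg1 => eqa.
  by move: eq; rewrite eqa => /mulgI.
have /choice[r rP] : forall g, exists b, B b /\ A (g * b^-1).
  by move=> g; have [a [b [Aa Bb ->]]] := AxB g; exists b; rewrite mulgK.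
have rE a b : A a -> B b -> r (a * b) = b.
  move=> Aa Bb; have [Br Ar] := rP (a * b).
  by apply: (uniqAB _ _ _ _ Ar Aa Br Bb); rewrite mulgVK.
exists r => [|x]; last by case: (rP x).
split=> [x y|x|b Bb].
- have [[Bx Ax] [By Ay]] := (rP x, rP y).
  (* Normality lets [r x] move past the [A]-part of [y]. *)
  rewrite -[RHS](rE (x * (r x)^-1 *
                     ((r x)^-1^-1 * (y * (r y)^-1) * (r x)^-1))).
  + by congr r; rewrite invgK !mulgA !mulgVK.
  + by apply: AM => //; apply: nA.
  + exact: BM.
- by case: (rP x).
- by rewrite -{1}(mul1g b) rE.
Qed.

Lemma retractionV B r x : retraction B r -> r x^-1 = (r x)^-1.
Proof.
case=> rM _ _; have r1 : r 1 = 1 by apply: (mulgI (r 1)); rewrite -rM !mulg1.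
by apply/esym/mulg1_eq; rewrite -rM mulgV.
Qed.

(** With [r = id] it compares two generating sets; with a retraction it makes the retraction
    Lipschitz. *)
Lemma word_length_comparison S S' r : generates S setT -> generates S' setT ->
    (forall x y, r (x * y) = r x * r y) ->
  exists M, forall g, word_length S' (r g) <= M * word_length S g.
Proof.
move=> genS genS' rM.
have r1 : r 1 = 1 by apply: (mulgI (r 1)); rewrite -rM !mulg1.
apply: (subadditive_bound genS (R := fun g n => word_length S' (r g) <= n)).
- by rewrite r1 word_length1.
- by move=> g m n mn /leq_trans; apply.
- move=> x y m n xm yn; rewrite rM.
  exact: leq_trans (word_lengthM genS' _ _) (leq_add xm yn).
- by move=> g; exists (word_length S' (r g)).
Qed.

(** The path is the image of a geodesic. Allowing every large [lam] lets one constant also serve for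
    quasigeodesics. *)
Lemma retract_undistorted S B r : generates S setT -> retraction B r ->
  exists M, forall lam, M <= lam -> coarsely_undistorted (word_dist S) lam B.
Proof.
move=> genS retr; have [rM rB rid] := retr.
have [M HM] := word_length_comparison genS genS rM.
exists M.+1 => lam Mlam u v Bu Bv.
have [c [geo c0 cn]] := exists_geodesic genS u v.
exists (word_dist S u v), (r \o c); split=> [||i _|i il] /=.
- by rewrite c0 cn !rid.
- by rewrite leq_pmull //; lia.
- exact: rB.
- rewrite /word_dist -(retractionV _ retr) -rM; apply: leq_trans (HM _) _.
  have := geo i i.+1; rewrite /word_dist leqnSn il subSnn => ->; lia.
Qed.

Lemma retract_quasiconvex S B r : generates S setT ->
    gromov_hyperbolic_space (word_dist S) -> retraction B r ->
  quasiconvex B.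
Proof.
move=> genS /gromov_hyperbolic_four_point[N hypS] retr S' genS'.
have metS := word_dist_pseudometric genS; have metS' := word_dist_pseudometric genS'.
have [M1 HM1] := word_length_comparison (r := id) genS' genS (fun _ _ => erefl).
have [M2 HM2] := word_length_comparison (r := id) genS genS' (fun _ _ => erefl).
have [M3 undist] := retract_undistorted genS retr.
pose lam := M1 + M2 + M3.
have [K1 near1] := geodesic_near_undistorted metS hypS lam.
have [K2 near2] := quasigeodesic_near_geodesic metS hypS lam.
(* In the [S]-metric, [K2] leads from the [S']-geodesic to an [S]-geodesic and [K1] from there to
   [B]; [M2] converts back to [S']. *)
exists (M2 * (K2 + K1))%N => x p /andP[/(pathP x) xp /eqP sp] Bx By z.
case/(nthP x) => i; rewrite /= ltnS => ip <-.
pose P i := nth x (x :: p) i; pose n := size p.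
have Pn : P n = last x p by rewrite /P -[n]/((size (x :: p)).-1) nth_last.
have geoP : geodesic (word_dist S') n P.
  apply: shortest_path_geodesic => // [j jn|]; last by rewrite Pn /n sp.
  exact/word_length_edge/xp.
have [c [geo c0 cn]] := exists_geodesic genS x (last x p).
have [t tL dt] : exists2 t, t <= word_dist S x (last x p) &
    word_dist S (P i) (c t) <= K2.
  apply: near2 (geo) _ _ i ip => [j k jk|j k jk||]; rewrite ?Pn //.
    rewrite -(geoP _ _ jk); apply: leq_trans (HM2 _) _.
    by rewrite leq_mul2r /lam; lia.
  rewrite -(geoP _ _ jk); apply: leq_trans (HM1 _) _.
  by rewrite leq_mul2r /lam; lia.
have [|||b Bb db] := near1 B _ c _ geo _ _ t tL; rewrite ?c0 ?cn //.
  by apply: undist; rewrite /lam; lia.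
exists b => //; apply: leq_trans (HM2 _) _; rewrite leq_mul2l.
have [_ _ /(_ (c t) (P i) b)] := metS.
by rewrite /word_dist /P in dt db * => ?; lia.
Qed.

End Retracts.

(** * Short representatives modulo powers of a commuting element *)

Section Centralizers.
Variables (G : groupType) (S : seq G) (N : nat).
Hypotheses (genS : generates S setT) (hypS : four_point (word_dist S) N).

(* For y shortest among the y b^m, hyperbolicity keeps y b^m in the annulus
   between |y| and |y| + N as long as |b^m| <= |y|, which forces
   |b^(2 m)| <= |b^m| + 2 N. This is incompatible with linear growth of |b^m|
   unless |y| is bounded. *)
Lemma commuting_shortest_bound b M c :
    (forall n, n <= M * word_length S (b ^+ n) + c) ->
  exists K, forall y, commute y b ->
    (forall m, word_length S y <= word_length S (y * b ^+ m)) ->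
    (forall m, word_length S y <= word_length S (y * b ^- m)) ->
  word_length S y <= K.
Proof.
move=> growth; pose g n := word_length S (b ^+ n).
(* [J] exceeds by one the bound that [exp2_le_linear] will give. A [y] longer than the sum below is
   longer than each [b ^+ (2 ^ j)] with [j <= J], so doubling applies [J] times. *)
pose J := (4 * (M * (2 * N) + (M * g 1 + c)))%N.+1.
exists (\sum_(j < J.+1) g (2 ^ j))%N => y yb min_pos min_neg.
rewrite leqNgt; apply/negP => big.
have gJ j : j <= J -> g (2 ^ j)%N <= word_length S y.
  move=> jJ; apply: leq_trans (ltnW big); have jJ' : j < J.+1 by [].
  by rewrite (bigD1 (Ordinal jJ')) //= leq_addr.
have ybm m : commute y (b ^+ m) by apply: commuteX.
have dbm x m : word_dist S x (x * b ^+ m) = g m by rewrite /word_dist mulKg.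
have dmid m : word_dist S (y * b ^+ m) (b ^+ m) = word_length S y.
  rewrite ybm -[X in word_dist _ _ X]mulg1 word_dist_mul2l //.
  by rewrite /word_dist mulg1 word_lengthV.
have dneg m : word_dist S y (b ^+ m) = word_length S (y * b ^- m).
  rewrite /word_dist -word_lengthV // invMg invgK.
  by rewrite (commuteV (ybm m)).
have annulus m : g m <= word_length S y ->
    word_length S (y * b ^+ m) <= word_length S y + N.
  (* By commutation, the quadrilateral 1, [y], [y * b ^+ m], [b ^+ m] has opposite sides of equal
     length; its diagonals have the lengths of [y * b ^+ m] and [y * b ^- m]. *)
  move=> gm; have := hypS 1 y (y * b ^+ m) (b ^+ m).
  by rewrite !word_dist1 dbm dmid dneg -/(g m); have := min_neg m; lia.
have double m : g m <= word_length S y -> g (m + m) <= word_length S y ->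
    g (m + m) <= g m + 2 * N.
  move=> gm g2m; have := hypS 1 y (y * b ^+ m) (y * b ^+ (m + m)).
  have -> : word_dist S (y * b ^+ m) (y * b ^+ (m + m)) = g m.
    by rewrite expgnDr mulgA dbm.
  rewrite !word_dist1 !dbm.
  by have := min_pos m; have := annulus _ g2m; lia.
have slow j : j <= J -> g (2 ^ j)%N <= g 1%N + 2 * N * j.
  elim: j => [|j IHj] jJ; first by rewrite muln0 addn0.
  have := double (2 ^ j)%N; rewrite addnn -mul2n -expnS.
  move=> /(_ (gJ _ (ltnW jJ)) (gJ _ jJ)); have := IHj (ltnW jJ); lia.
have := growth (2 ^ J)%N; rewrite -/(g _) => le2J.
suff : J <= 4 * (M * (2 * N) + (M * g 1%N + c)) by rewrite ltnn.
apply: exp2_le_linear; apply: leq_trans le2J _.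
have : M * g (2 ^ J)%N <= M * (g 1%N + 2 * N * J) by rewrite leq_mul2l slow ?orbT.
by lia.
Qed.

End Centralizers.

(** * Malnormality of the free factor *)

Section Malnormality.
Variables (G : groupType) (A B : set G) (S : seq G).
Hypotheses (sdAB : is_semidirect A B) (freeA : is_free A) (freeB : is_free B).
Hypotheses (genS : generates S setT).
Hypotheses (hypS : gromov_hyperbolic_space (word_dist S)).

(** Retracting the generators to [B] and writing them over a free basis turns a word for [b ^+ n]
    into a basis word of proportional length. *)
Lemma free_retract_power_growth b : B b -> b <> 1 ->
  exists M c, forall n, n <= M * word_length S (b ^+ n) + c.
Proof.
move=> Bb b1; have [X freeX] := freeB.
have [r [rM rB rid] _] := semidirect_retraction sdAB.
have [_ [B1 BM _] _ _ _] := sdAB.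
have [c cP] := free_power_growth freeX Bb b1.
have [M MP] : exists M, forall g, exists w,
    [/\ word_in X w, eval_word w = r g & size w <= M * word_length S g].
  apply: (subadditive_bound genS (R := fun g n => exists w,
    [/\ word_in X w, eval_word w = r g & size w <= n])).
  - by exists [::]; rewrite eval_word_nil rid.
  - by move=> g m n mn [w [Xw ew sw]]; exists w; rewrite (leq_trans sw).
  - move=> x y m n [v [Xv ev sv]] [w [Xw ew sw]]; exists (v ++ w).
    rewrite eval_word_cat size_cat ev ew rM leq_add //.
    by split=> //; apply/word_in_cat.
  - by move=> g; have [w [[Xw _ ew] _]] := freeX.2 _ (rB g); exists (size w), w.
exists M, c => n; have [w [Xw ew sw]] := MP (b ^+ n).
have Bbn : B (b ^+ n) by elim: (n) => // k IHk; rewrite expgS; apply: BM.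
by have := cP n w Xw; rewrite ew rid // => /(_ erefl); lia.
Qed.

(* Each coset a^k C, with C the centralizer of b in B, meets a ball of fixed
   radius, which is impossible if these cosets are pairwise distinct. *)
Lemma commuting_factors_trivial a b : A a -> B b -> commute a b -> b <> 1 -> a = 1.
Proof.
move=> Aa Bb ab b1; apply: contrapT => a1.
have [N hypN] := gromov_hyperbolic_four_point hypS.
have [M [c growth]] := free_retract_power_growth Bb b1.
have [K HK] := commuting_shortest_bound genS hypN growth.
have [[A1 AM AV] [B1 BM BV] _ AIB _] := sdAB.
have Bbn n : B (b ^+ n) by elim: n => // k IHk; rewrite expgS; apply: BM.
have /choice[f fP] : forall k, exists y,
    word_length S y <= K /\ exists h, B h /\ y = a ^+ k * h.
  (* A shortest element of the coset commutes with [b] and is not shortened by powers of [b], as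
     [commuting_shortest_bound] requires. *)
  move=> k; pose P n := `[< exists h, [/\ B h, commute h b &
    word_length S (a ^+ k * h) = n] >].
  have exP : exists n, P n.
    exists (word_length S (a ^+ k)); apply/asboolP; exists 1; rewrite mulg1.
    by split=> //; apply/commute_sym/commute1.
  case: (ex_minnP exP) => _ /asboolP[h [Bh hb <-]] minh.
  exists (a ^+ k * h); split; last by exists h.
  apply: HK => [|m|m].
  - apply: commute_sym; apply: commuteM; last exact: commute_sym.
    by apply: commuteX; apply: commute_sym.
  - apply: minh; apply/asboolP; exists (h * b ^+ m); rewrite mulgA; split=> //.
      exact: BM.
    by apply: commute_sym; apply: commuteM; [exact: commute_sym | exact: commuteX].
  - apply: minh; apply/asboolP; exists (h * b ^- m); rewrite mulgA; split=> //.
      by apply: BM => //; apply: BV.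
    apply: commute_sym; apply: commuteM; first exact: commute_sym.
    by apply: commuteV; apply: commuteX.
have f_inj k l : k <= l -> f k = f l -> k = l.
  move=> kl; have [_ [h [Bh ->]]] := fP k; have [_ [h' [Bh' ->]]] := fP l.
  rewrite -(subnKC kl) expgnDr -mulgA => /mulgI eq.
  have : (A `&` B) (a ^+ (l - k)).
    split; first by elim: (l - k)%N => // n IHn; rewrite expgS; apply: AM.
    by rewrite -(mulgK h' (a ^+ _)) -eq; apply: BM => //; apply: BV.
  by rewrite AIB => /(free_torsion_free freeA Aa a1); lia.
have [E HE] := finite_ball genS K.
have : size [seq f k | k <- iota 0 (size E).+1] <= size E.
  apply: uniq_leq_size => [|_ /mapP[k _ ->]]; last by apply: HE; case: (fP k).
  rewrite map_inj_uniq ?iota_uniq // => k l eq.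
  by case: (leqP k l) => [|/ltnW] kl; [|apply/esym]; apply: f_inj.
by rewrite size_map size_iota ltnn.
Qed.

Lemma semidirect_malnormal : malnormal B.
Proof.
move=> g nBg; have [r retr Ar] := semidirect_retraction sdAB.
have [rM rB rid] := retr; have [_ [B1 _ _] _ _ _] := sdAB.
apply/seteqP; split=> [_ [[b Bb <-] Bx]|_ ->]; last first.
  by split=> //; exists 1; rewrite // mulg1 mulVg.
(* The conjugate lies in [B], so the retraction fixes it; hence the [A]-part of [g] commutes with
   [b]. *)
have fix_r : g^-1 * b * g = (r g)^-1 * b * r g.
  by rewrite -(rid _ Bx) !rM (retractionV _ retr) (rid b).
have comm : commute (g * (r g)^-1) b.
  have := congr1 (fun x => g * x * (r g)^-1) fix_r.
  by rewrite !mulgA mulgV mul1g mulgK /commute mulgA => ->.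
apply: contrapT => x1; apply: nBg.
have /divg1_eq-> // : g * (r g)^-1 = 1.
apply: commuting_factors_trivial (Ar g) Bb comm _ => b1.
by apply: x1; rewrite b1 /= mulg1 mulVg.
Qed.

End Malnormality.

Theorem lemma6p5 (G : groupType) (A B : set G) :
  is_semidirect A B ->
  finitely_generated A -> is_free A ->
  finitely_generated B -> is_free B ->
  hyperbolic_group G ->
  quasiconvex B /\ malnormal B.
Proof.
move=> sd _ freeA _ freeB [S genS hypS]; split.
  have [r retr _] := semidirect_retraction sd.
  exact: retract_quasiconvex genS hypS retr.
exact: semidirect_malnormal sd freeA freeB genS hypS.
Qed.
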